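(* Let $G$ be a loopless multigraph on $[n]$, and let $Q_G^{\mathcal{O}}(\mathfrak{b};{\bf x})$ be the reduced form of $G$ in the subdivision algebra $\mathcal{S}(\mathfrak{b})$ obtained by performing reductions in the order $\mathcal{O}$. Let $Q_G^{\mathcal{O}}(\mathfrak{b}-{\bf 1})$ denote the specialization of $Q_G^{\mathcal{O}}(\mathfrak{b};{\bf x})$ at ${\bf x}=(1,\ldots,1)$ with each $\beta_i$ replaced by $\beta_i-1$. Then $$Q_G^{\mathcal{O}}(\mathfrak{b}-{\bf 1})=h(\mathcal{C},\mathfrak{b}).$$ In particular, $Q_G^{\mathcal{O}}(\mathfrak{b}-{\bf 1})$ has nonnegative integer coefficients.
   Context: Graphs are finite loopless multigraphs on $[n]$, edges $(i,j)$ with $i<j$. Reduction on edges $a=(i,j)$, $b=(j,k)$, $i<j<k$, of a graph $H$ produces $H_1$ ($E(H)\setminus\{b\}\cup\{(i,k)\}$), $H_2$ ($E(H)\setminus\{a\}\cup\{(i,k)\}$), $H_3$ ($E(H)\setminus\{a,b\}\cup\{(i,k)\}$), the new edge $(i,k)$ being formally $a+b$. A reduction tree of $G$ is a rooted tree of graphs with root $G$, each non-leaf node having three children from one reduction, ordered left $H_1$, middle $H_3$, right $H_2$; leaves are the graphs with no pair $(i,j),(j,k)$, $i<j<k$. Every edge is a formal sum of edges of $G$ (edges of $G$ distinguished); edges of different graphs are equal iff they are sums of the same edges of $G$; $H\cap H'$ is the graph of common edges. A leaf is full dimensional if it has $|E(G)|$ edges. Depth-first search order: left subtree, middle, right, recursively.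 Order $\mathcal{O}$: at a non-leaf node, take the smallest vertex $v$ having edges $(a,v)$, $a<v$, and $(v,b)$, $b>v$, and reduce on such edges with $a$ minimal and $b$ maximal; this gives $R_G^{\mathcal{O}}$. Reduced form: with variables $x_{ij}$ and parameters $\mathfrak{b}=(\beta_1,\dots,\beta_{n-1})$, $Q_G^{\mathcal{O}}(\mathfrak{b};{\bf x})=\sum_L \mathfrak{b}(L)\prod_{(i,j)\in E(L)}x_{ij}$, summed over all leaves $L$ of $R_G^{\mathcal{O}}$, where $\mathfrak{b}(L)=\prod \beta_{i}$ over the reductions on the path from $G$ to $L$ at which one goes to the middle child, $i$ being the smallest vertex of the reduced pair $(i,j),(j,k)$. (This is the result of repeatedly replacing $x_{ij}x_{jk}$ by $x_{ik}x_{ij}+x_{jk}x_{ik}+\beta_i x_{ik}$ in the commutative monomial $\prod_{(i,j)\in E(G)}x_{ij}$ in the order $\mathcal{O}$.) The $h(\mathfrak{b})$-polynomial: let $F_1,\dots,F_l$ be the full dimensional leaves of $R_G^{\mathcal{O}}$ in depth-first search order and $P_i=\{\{Q^i_1,\dots,Q^i_{f(i)}\}\}=\{\{F_i\cap F_j: j<i,\ |E(F_i\cap F_j)|=|E(F_i)|-1\}\}$. Each $Q^i_j$ is a leaf of $R_G^{\mathcal{O}}$ with $|E(G)|-1$ edges, so the path from $G$ to $Q^i_j$ contains exactly one step to a middle child; if that reduction is on edges $(a,c),(c,d)$, set $w(Q^i_j)=\beta_a$. Define $h(\mathcal{C},\mathfrak{b})=\sum_{i=1}^l\prod_{j=1}^{f(i)}w(Q^i_j)$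 (empty product $=1$); here $\mathcal{C}$ is the canonical triangulation of the flow polytope of the augmented graph of $G$ given by the full dimensional leaves.
   Formalization: The depth-first search visits the right subtree (H_2) first, then the middle, then the left (H_1), since with left first the identity fails for the path 12, 23, 34; ties among parallel edges in the order O are broken by fixed total orders on formal sums. *)

(* Defs.v *)
(* MathComp + multinomials. *)
From HB Require Import structures.
From mathcomp Require Import all_boot all_order all_algebra.
From mathcomp Require Import mpoly zify.

Set Implicit Arguments.
Unset Strict Implicit.
Unset Printing Implicit Defensive.

Import Order.TTheory GRing.Theory Num.Theory.

Section Graphs.
Variables n m : nat.

(* Vertices are 0, ..., n-1 (the vertex usually written i is i - 1 here); the
   edges of the root graph are indexed by 'I_m.  An edge (i, j) of a graph in
   a reduction tree carries the formal sum of root edges it stands for, an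
   element of the free commutative monoid 'X_{1..m}.  That sum determines i
   and j, so Leibniz equality of edges is equality of formal sums. *)
Definition edge : Type := ('I_n * 'I_n * 'X_{1..m})%type.
Definition src (e : edge) : 'I_n := e.1.1.
Definition tgt (e : edge) : 'I_n := e.1.2.
Definition fsum (e : edge) : 'X_{1..m} := e.2.

Definition graph : Type := seq edge.

Definition root_graph (G : m.-tuple ('I_n * 'I_n)) : graph :=
  [seq (tnth G k, U_(k)%MM) | k <- enum 'I_m].

Definition join (a b : edge) : edge := (src a, tgt b, (fsum a + fsum b)%MM).

Definition reducible (a b : edge) : bool :=
  [&& src a < tgt a, tgt a == src b & src b < tgt b].

Definition red1 (H : graph) (a b : edge) : graph := join a b :: rem b H.
Definition red2 (H : graph) (a b : edge) : graph := join a b :: rem a H.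
Definition red3 (H : graph) (a b : edge) : graph := join a b :: rem a (rem b H).

Definition irreducible (H : graph) : bool :=
  ~~ has (fun a => has (reducible a) H) H.

(* [Node a b t2 t3 t1]: reduction on a, b, with the subtrees of red2, red3 and
   red1 in this order. *)
Inductive rtree : Type :=
| Leaf of graph
| Node of edge & edge & rtree & rtree & rtree.

(* [T] is a reduction tree of [H] in which every reduction obeys [rule]. *)
Fixpoint reduction_tree (rule : graph -> edge -> edge -> bool)
    (H : graph) (T : rtree) : bool :=
  match T with
  | Leaf L => (L == H) && irreducible H
  | Node a b t2 t3 t1 =>
      [&& a \in H, b \in H, reducible a b, rule H a b,
          reduction_tree rule (red2 H a b) t2,
          reduction_tree rule (red3 H a b) t3
        & reduction_tree rule (red1 H a b) t1]
  end.

(* The order O.  Among edges (a, v) with the same a (resp. (v, b) with the same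
   b) the first one for a fixed order [tI] (resp. [tO]) on formal sums is
   chosen; without such a uniform choice the full dimensional leaves need not
   form a triangulation. *)
Definition order_O (tI tO : rel 'X_{1..m}) (H : graph) (a b : edge) : bool :=
  [&& all (fun a' => all (fun b' => reducible a' b' ==> (tgt a <= tgt a')) H) H,
      all (fun a' => (tgt a' == tgt a) ==>
             ((src a < src a')
              || (src a == src a') && tI (fsum a) (fsum a'))) H
    & all (fun b' => (src b' == src b) ==>
             ((tgt b' < tgt b)
              || (tgt b' == tgt b) && tO (fsum b) (fsum b'))) H].

Definition total_order (T : Type) (r : rel T) : Prop :=
  [/\ antisymmetric r, transitive r & total r].

Lemma all_min (T : eqType) (r : rel T) (s : seq T) :
  transitive r -> total r -> s != [::] -> exists2 x, x \in s & all (r x) s.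
Proof.
move=> rtr rto; elim: s => // x s IHs _.
have rxx y : r y y by have := rto y y; rewrite orbb.
have [->|s0] := eqVneq s [::].
  by exists x; rewrite ?mem_head //= rxx.
have [y ys ymin] := IHs s0.
have [rxy|ryx] := orP (rto x y).
  exists x; rewrite ?mem_head //= rxx /=.
  by apply/allP => z zs; apply: rtr rxy (allP ymin z zs).
by exists y; rewrite ?inE ?ys ?orbT //= ryx.
Qed.

(* The order O can always be followed down to the leaves. *)
Lemma order_O_exists (tI tO : rel 'X_{1..m}) (H : graph) :
  total_order tI -> total_order tO ->
  exists T, reduction_tree (order_O tI tO) H T.
Proof.
move=> [_ trI toI] [_ trO toO].
pose len (e : edge) := (n - (tgt e - src e))%N.
pose mu (H : graph) := (\sum_(e <- H) len e)%N.
have muC e K : mu (e :: K) = (len e + mu K)%N by rewrite /mu big_cons.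
have muR e K : e \in K -> mu K = (len e + mu (rem e K))%N.
  by move=> eK; rewrite /mu (perm_big _ (perm_to_rem eK)) big_cons.
have [k] := ubnP (mu H); elim: k H => // k IHk H muH.
have [irrH|] := boolP (irreducible H).
  by exists (Leaf H); rewrite /= eqxx.
rewrite negbK => /hasP[a0 a0H /hasP[b0 b0H red0]].
have [a1] : exists2 a, a \in [seq a <- H | has (reducible a) H] &
    all (fun a' => (tgt a <= tgt a')%N) [seq a <- H | has (reducible a) H].
  apply: all_min => [x y z|x y|]; [exact: leq_trans|exact: leq_total|].
  apply/eqP => H0; have : a0 \in [seq a <- H | has (reducible a) H].
    by rewrite mem_filter a0H andbT; apply/hasP; exists b0.
  by rewrite H0.
rewrite mem_filter => /andP[/hasP[b1 b1H red1'] a1H] /allP a1min.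
pose I := [seq e <- H | tgt e == tgt a1]; pose O := [seq e <- H | src e == src b1].
have [a aI amin] : exists2 a, a \in I & all (fun a' => (src a < src a')%N
    || (src a == src a') && tI (fsum a) (fsum a')) I.
  apply: all_min => [y x z|x y|].
  - case/orP => [xy|/andP[/eqP xy txy]]; case/orP => [yz|/andP[/eqP yz tyz]].
    + by rewrite (ltn_trans xy yz).
    + by rewrite -yz xy.
    + by rewrite xy yz.
    + by rewrite xy yz eqxx (trI _ _ _ txy tyz) orbT.
  - have [_|_|xy] := ltngtP (src x) (src y); rewrite ?orbT //=.
    by rewrite (val_inj xy) eqxx; exact: toI.
  - apply/eqP => I0; have : a1 \in I by rewrite mem_filter eqxx a1H.
    by rewrite I0.
have [b bO bmax] : exists2 b, b \in O & all (fun b' => (tgt b' < tgt b)%N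
    || (tgt b' == tgt b) && tO (fsum b) (fsum b')) O.
  apply: all_min => [y x z|x y|].
  - case/orP => [xy|/andP[/eqP xy txy]]; case/orP => [yz|/andP[/eqP yz tyz]].
    + by rewrite (ltn_trans yz xy).
    + by rewrite yz xy.
    + by rewrite -xy yz.
    + by rewrite -xy yz eqxx (trO _ _ _ txy tyz) orbT.
  - have [_|_|xy] := ltngtP (tgt x) (tgt y); rewrite ?orbT //=.
    by rewrite (val_inj xy) eqxx; exact: toO.
  - apply/eqP => O0; have : b1 \in O by rewrite mem_filter eqxx b1H.
    by rewrite O0.
move: aI bO; rewrite !mem_filter => /andP[/eqP ta aH] /andP[/eqP sb bH].
have /and3P[s1 /eqP ts1 t1] := red1'.
have sa : (src a < tgt a)%N.
  have /allP/(_ a1) := amin; rewrite mem_filter eqxx a1H ta => /(_ isT).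
  case/orP => [h|/andP[/eqP -> _] //]; exact: ltn_trans h s1.
have tb : (src b < tgt b)%N.
  have /allP/(_ b1) := bmax; rewrite mem_filter eqxx b1H sb => /(_ isT).
  case/orP => [h|/andP[/eqP <- _] //]; exact: ltn_trans t1 h.
have redab : reducible a b by rewrite /reducible sa tb ta sb ts1 eqxx.
have Oab : order_O tI tO H a b.
  apply/and3P; split; apply/allP => e eH.
  - apply/allP => e' e'H; apply/implyP => redee'; rewrite ta; apply: a1min.
    by rewrite mem_filter eH andbT; apply/hasP; exists e'.
  - apply/implyP => /eqP te; apply: (allP amin).
    by rewrite mem_filter eH te ta eqxx.
  - apply/implyP => /eqP se; apply: (allP bmax).
    by rewrite mem_filter eH se sb eqxx.
have ab : (tgt a = src b :> nat) by rewrite ta sb ts1.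
have ne_ab : b != a by apply/eqP => e; move: sa; rewrite ab e ltnn.
have lj : (len (join a b) < minn (len a) (len b))%N.
  have -> : len (join a b) = (n - (tgt b - src a))%N by [].
  rewrite /len; have := ltn_ord (tgt b); move: sa tb ab.
  by clear; case: (tgt b) (src b) (tgt a) (src a) => k ? [j ?] [j' ?] [i ?] /=; lia.
have aHb : a \in rem b H.
  by move: aH; rewrite (perm_mem (perm_to_rem bH)) inE eq_sym (negPf ne_ab).
have lt1 : (mu (red1 H a b) < k)%N.
  rewrite muC; apply: leq_trans _ (muH : mu H <= k)%N.
  by rewrite (muR _ _ bH) ltn_add2r; move: lj; rewrite leq_min => /andP[].
have lt2 : (mu (red2 H a b) < k)%N.
  rewrite muC; apply: leq_trans _ (muH : mu H <= k)%N.
  by rewrite (muR _ _ aH) ltn_add2r; move: lj; rewrite leq_min => /andP[].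
have lt3 : (mu (red3 H a b) < k)%N.
  apply: leq_ltn_trans lt1.
  by rewrite !muC leq_add2l (muR _ _ aHb) leq_addl.
have [T1 T1P] := IHk _ lt1; have [T2 T2P] := IHk _ lt2.
have [T3 T3P] := IHk _ lt3.
by exists (Node a b T2 T3 T1); rewrite /= aH bH redab Oab T1P T2P T3P.
Qed.

(* The leaves in depth-first order; each leaf comes with the list of the
   smallest vertices of the pairs reduced at the steps to a middle child on the
   path from the root.

   The subtree of red2 is visited before that of red1.  The order matters for
   [h_poly] because of the weights: for the path 1 - 2 - 3 - 4, visiting
   red1 first gives 1 + 3 b1 + b1 b2, whereas the shifted reduced form is
   1 + 2 b1 + b2 + b1^2, which is what visiting red2 first gives. *)
Fixpoint leaves (T : rtree) : seq (graph * seq 'I_n) :=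
  match T with
  | Leaf L => [:: (L, [::])]
  | Node a b t2 t3 t1 =>
      leaves t2 ++ [seq (L.1, src a :: L.2) | L <- leaves t3] ++ leaves t1
  end.

Local Open Scope ring_scope.

(* The variable x_ij. *)
Definition xvar (i j : 'I_n) : 'I_#|{: 'I_n * 'I_n}| := enum_rank (i, j).

(* The reduced form, as a polynomial in x over Z[b].  There is one parameter b_i
   for each vertex i; the one of the last vertex never occurs. *)
Definition reduced_form (T : rtree) :
    {mpoly {mpoly int[n]}[#|{: 'I_n * 'I_n}|]} :=
  \sum_(L <- leaves T)
    (\prod_(i <- L.2) 'X_i) *: \prod_(e <- L.1) 'X_(xvar (src e) (tgt e)).

Definition shifted_reduced_form (T : rtree) : {mpoly int[n]} :=
  (reduced_form T).@[fun _ => 1] \mPo [tuple 'X_i - 1 | i < n].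

Definition common (H H' : graph) : graph := [seq e <- H | e \in H'].

Definition full_leaves (T : rtree) : seq graph :=
  [seq L <- [seq L.1 | L <- leaves T] | size L == m].

(* The multiset P_i, i < size (full_leaves T). *)
Definition facets (T : rtree) (i : nat) : seq graph :=
  let F := nth [::] (full_leaves T) i in
  [seq Q <- [seq common F F' | F' <- take i (full_leaves T)]
     | (size Q).+1 == size F].

(* The weight of a leaf with exactly one middle step; 0 is a dummy value for the
   other graphs. *)
Definition weight (T : rtree) (Q : graph) : {mpoly int[n]} :=
  match [seq L.2 | L <- leaves T & perm_eq L.1 Q] with
  | [:: a] :: _ => 'X_a
  | _ => 0
  end.

Definition h_poly (T : rtree) : {mpoly int[n]} :=
  \sum_(i < size (full_leaves T)) \prod_(Q <- facets T i) weight T Q.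

End Graphs.

(* Main.v *)
Require Import Defs.
From mathcomp Require Import all_boot all_order all_algebra.
From mathcomp Require Import mpoly.

(** Attach to each full dimensional leaf F the multiset of weights of P_F.  For a
    reduction on (p, q), let psi be the functional p^* - q^* in the dual basis of
    the edges.  It is nonnegative on the leaves of H1, nonpositive on those of H2
    and zero on those of H3, so a leaf F of H1 meets the leaves of H2 in a facet
    only if exactly one edge of F has psi <> 0.  Deleting this edge is a bijection
    from such leaves F onto the full dimensional leaves of H3, and it preserves
    the weights of P_F.  Thus if s is the sum of the products of weights,
    s(H) = s(H2) + s(H1) + (beta - 1) s(H3), which is the recursion of the
    shifted reduced form.

    The bijection is a special case of: the full dimensional leaves of H minus an
    edge a are those of H with exactly one edge through a, with this edge deleted.
    In the induction either the order O picks the same pair in both graphs, or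
    a is in the reduced pair; in that case one of the children has two edges
    through a, which are never merged, and the other one reduces to the
    same claim.  Weights are also preserved when no edge ends at the source of a. *)

Set Implicit Arguments.
Unset Strict Implicit.
Unset Printing Implicit Defensive.

Import Order.TTheory GRing.Theory Num.Theory.
Local Open Scope ring_scope.

Section ReductionTrees.
Variables n m : nat.
Local Notation edge := (edge n m).
Local Notation graph := (graph n m).
Local Notation rtree := (rtree n m).
Implicit Types (H K F : graph) (a b c e p q : edge) (T : rtree).
Implicit Types (phi psi chi : 'I_m -> int).

(** * Linear functionals on formal sums *)

Definition ev phi e : int := \sum_k phi k * (fsum e k)%:Z.

Lemma ev_join phi a b : ev phi (join a b) = ev phi a + ev phi b.
Proof.
by rewrite -big_split; apply: eq_bigr => k _ /=; rewrite mnmDE PoszD mulrDr.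
Qed.

Lemma evB phi psi e : ev (fun k => phi k - psi k) e = ev phi e - ev psi e.
Proof. by rewrite -sumrB; apply: eq_bigr => k _; rewrite mulrBl. Qed.

(* The edges of a good graph have linearly independent formal sums; [f e] is
   the coordinate of [e] in the dual basis. *)
Definition good H :=
  [/\ uniq H, forall e, e \in H -> (src e < tgt e)%N
    & exists f : edge -> 'I_m -> int,
        {in H &, forall e e', ev (f e) e' = (e == e')%:R}].

Lemma good_sub H K : uniq K -> {subset K <= H} -> good H -> good K.
Proof.
move=> uK sKH [_ fwd [f fP]]; split=> // [e /sKH /fwd //|].
by exists f => e e' /sKH eH /sKH e'H; apply: fP.
Qed.

Lemma reducible_neq a b : reducible a b -> a != b.
Proof.
by case/and3P => sa /eqP ab _; apply/eqP => e; move: sa; rewrite ab e ltnn.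
Qed.

(** The dual vector of [a] is 1 on [join a b], so an edge of [H] equal to the join could only be
    [a]; by symmetry it would also be [b]. *)
Lemma join_notin H a b :
  good H -> a \in H -> b \in H -> a != b -> join a b \notin H.
Proof.
move=> [_ _ [f fP]] aH bH ab; apply/negP => cH.
have ca : a = join a b.
  have := fP _ _ aH cH; rewrite ev_join !fP // eqxx (negPf ab) addr0.
  by case: eqP.
have cb : b = join a b.
  have := fP _ _ bH cH; rewrite ev_join !fP // eqxx eq_sym (negPf ab) add0r.
  by case: eqP.
by case/eqP: ab; rewrite ca -cb.
Qed.

Lemma in_rem (s : seq edge) x y :
  uniq s -> (y \in rem x s) = (y != x) && (y \in s).
Proof. by move=> us; rewrite mem_rem_uniq // inE. Qed.

Lemma rem_cons (s : seq edge) x y :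
  rem x (y :: s) = if y == x then s else y :: rem x s.
Proof. by []. Qed.

Lemma remC (s : seq edge) x y : uniq s -> rem x (rem y s) = rem y (rem x s).
Proof.
move=> us; rewrite (rem_filter x (rem_uniq y us)) (rem_filter y (rem_uniq x us)).
rewrite (rem_filter x us) (rem_filter y us) -!filter_predI.
by apply: eq_filter => e /=; rewrite andbC.
Qed.

(* Comparing memberships in different [rem]s by unfolding is very slow. *)
Local Opaque rem.

(* [x] and [x + y] is a basis of the lattice spanned by [x] and [y]. *)
Lemma good_exchange H x y c :
  good H -> x \in H -> y \in H -> x != y -> c \notin H ->
  (forall phi, ev phi c = ev phi x + ev phi y) -> (src c < tgt c)%N ->
  good (c :: rem y H).
Proof.
move=> [uH fwd [f fP]] xH yH xy cH evc fwdc.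
have rP e := in_rem y e uH.
split=> [|e|].
- by rewrite /= rP (negPf cH) andbF rem_uniq.
- by rewrite inE rP => /orP[/eqP ->|/andP[_ /fwd]].
have cx : (x == c) = false by apply: contraNF cH => /eqP <-.
(* New dual basis: [c] takes over the coordinate of [y], and the coordinate of [x] is corrected by
   [- f y] so that it vanishes on [c], which counts for both [x] and [y]. *)
exists (fun e => if e == c then f y else
  if e == x then fun k => f x k - f y k else f e).
move=> e e'; rewrite !inE !rP.
have [->|ec] := eqVneq e c => /= [_|/andP[ey eH]].
  have [->|e'c] := eqVneq e' c => /= [_|/andP[e'y e'H]].
    by rewrite evc !fP // (eq_sym y x) (negPf xy) eqxx.
  by rewrite fP // eq_sym (negPf e'y).
have [->|e'c] := eqVneq e' c => /= [_|/andP[e'y e'H]].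
  rewrite evc (negPf ec); have [_|ex] := eqVneq e x.
    by rewrite !evB !fP // !eqxx (negPf xy) eq_sym (negPf xy) subr0 sub0r subrr.
  by rewrite !fP // (negPf ex) (negPf ey).
have [->|ex] := eqVneq e x; last by rewrite fP.
by rewrite evB !fP // (eq_sym y) (negPf e'y) subr0.
Qed.

Lemma red3_red1 H a b :
  good H -> a \in H -> b \in H -> reducible a b ->
  red3 H a b = rem a (red1 H a b).
Proof.
move=> gH aH bH /reducible_neq ab; rewrite /red3 /red1 rem_cons.
by case: eqP => // ca; move: (join_notin gH aH bH ab); rewrite ca aH.
Qed.

Lemma red3_red2 H a b :
  good H -> a \in H -> b \in H -> reducible a b ->
  perm_eq (red3 H a b) (rem b (red2 H a b)).
Proof.
move=> gH aH bH /reducible_neq ab; rewrite /red3 /red2 rem_cons.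
case: eqP => [cb|_]; first by move: (join_notin gH aH bH ab); rewrite cb bH.
have [uH _ _] := gH.
by rewrite remC.
Qed.

Lemma reducible_join_lt a b : reducible a b -> (src a < tgt b)%N.
Proof.
case/and3P => sa /eqP ab; rewrite -ab; exact: ltn_trans.
Qed.

Lemma good_red1 H a b :
  good H -> a \in H -> b \in H -> reducible a b -> good (red1 H a b).
Proof.
move=> gH aH bH ab; apply: (good_exchange gH aH bH).
- exact: reducible_neq.
- exact: join_notin (reducible_neq ab).
- by move=> phi; rewrite ev_join.
- exact: reducible_join_lt ab.
Qed.

Lemma good_red2 H a b :
  good H -> a \in H -> b \in H -> reducible a b -> good (red2 H a b).
Proof.
move=> gH aH bH ab; apply: (good_exchange gH bH aH).
- by rewrite eq_sym; exact: reducible_neq.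
- exact: join_notin (reducible_neq ab).
- by move=> phi; rewrite ev_join addrC.
- exact: reducible_join_lt ab.
Qed.

Lemma good_rem H a : good H -> good (rem a H).
Proof.
move=> gH; have [uH _ _] := gH.
by apply: good_sub gH; rewrite ?rem_uniq // => e; exact: mem_rem.
Qed.

Lemma good_red3 H a b :
  good H -> a \in H -> b \in H -> reducible a b -> good (red3 H a b).
Proof.
by move=> gH aH bH ab; rewrite red3_red1 //; apply/good_rem/good_red1.
Qed.

(** * Invariants passed from a graph to its children *)

Definition stable (P : graph -> Prop) :=
  forall H a b, a \in H -> b \in H -> reducible a b -> P H ->
  [/\ P (red1 H a b), P (red2 H a b) & P (red3 H a b)].

Lemma leaves_stable rule P T H :
  stable P -> reduction_tree rule H T -> P H ->
  forall X, X \in leaves T -> P X.1.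
Proof.
move=> stP; elim: T H => [K|a b t2 IH2 t3 IH3 t1 IH1] H /=.
  by case/andP => /eqP -> _ PH L; rewrite inE => /eqP ->.
case/and5P => aH bH ab _ /and3P[rt2 rt3 rt1] PH L.
have [P1 P2 P3] := stP _ _ _ aH bH ab PH.
rewrite !mem_cat => /or3P[/(IH2 _ rt2 P2) //| |/(IH1 _ rt1 P1) //].
by case/mapP => L' L't -> /=; exact: (IH3 _ rt3 P3).
Qed.

Lemma good_stable : stable good.
Proof.
by move=> H a b *; split; [exact: good_red1|exact: good_red2|exact: good_red3].
Qed.

Lemma mem_red H a b e :
  [/\ e \in red1 H a b -> e = join a b \/ e \in H,
      e \in red2 H a b -> e = join a b \/ e \in H
    & e \in red3 H a b -> e = join a b \/ e \in H].
Proof.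
have cons_or K :
  {subset K <= H} -> e \in join a b :: K -> e = join a b \/ e \in H.
  by move=> KH; rewrite inE => /predU1P[->|/KH]; [left|right].
by split; apply: cons_or => e' /mem_rem // /mem_rem.
Qed.

Lemma all_stable (A : edge -> Prop) :
  (forall a b, reducible a b -> A a -> A b -> A (join a b)) ->
  stable (fun H => forall e, e \in H -> A e).
Proof.
move=> AJ H a b aH bH ab AH.
have AR e : e = join a b \/ e \in H -> A e.
  by case=> [->|/AH //]; apply: AJ => //; apply: AH.
by split=> e; have [h1 h2 h3] := mem_red H a b e; [move/h1|move/h2|move/h3] => /AR.
Qed.

Lemma mem_rem_neq (s : seq edge) x y : y \in s -> y != x -> y \in rem x s.
Proof.
have [xs|xs] := boolP (x \in s); last by rewrite rem_id.
by rewrite (perm_mem (perm_to_rem xs)) inE => /predU1P[->|//]; rewrite eqxx.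
Qed.

Definition positive phi H :=
  (forall e, e \in H -> 0 <= ev phi e) /\ (exists2 e, e \in H & ev phi e != 0).

Lemma nonneg_stable phi : stable (fun H => forall e, e \in H -> 0 <= ev phi e).
Proof. by apply: all_stable => a b _ pa pb; rewrite ev_join addr_ge0. Qed.

(** An edge of nonzero value can disappear only as part of the reduced pair, and then the join,
    whose value is a sum of nonnegative terms, is nonzero. *)
Lemma positive_stable phi : stable (positive phi).
Proof.
move=> H a b aH bH ab [ge0 [e eH pe]].
have [ge1 ge2 ge3] := nonneg_stable aH bH ab ge0.
have [c0|c0] := boolP (ev phi (join a b) == 0); last first.
  by split; split=> //; exists (join a b); rewrite ?mem_head.
move: c0; rewrite ev_join paddr_eq0 ?ge0 // => /andP[a0 b0].
have ea : e != a by apply: contra pe => /eqP ->.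
have eb : e != b by apply: contra pe => /eqP ->.
split; split=> //; exists e => //; rewrite inE ?mem_rem_neq ?orbT //.
Qed.

Lemma vanish_stable phi : stable (fun H => forall e, e \in H -> ev phi e = 0).
Proof. by apply: all_stable => a b _; rewrite ev_join => -> ->. Qed.

(* If the edges in the supports of [phi] and [psi] lie in a class [S] no two
   members of which are ever joined, then the supports stay disjoint. *)
Lemma disjoint_stable (A S : edge -> Prop) phi psi :
  (forall a b, reducible a b -> A a -> A b -> A (join a b)) ->
  (forall a b, reducible a b -> A a -> A b -> S a -> ~ S b) ->
  (forall a b, reducible a b -> A a -> A b -> S a \/ S b -> S (join a b)) ->
  stable (fun H => forall e, e \in H ->
    [/\ A e, ev phi e != 0 \/ ev psi e != 0 -> S e
      & ev phi e = 0 \/ ev psi e = 0]).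
Proof.
move=> AJ Sx SJ; apply: all_stable => a b ab [Aa sa da] [Ab sb db].
have nS := Sx _ _ ab Aa Ab.
split; first exact: AJ.
- rewrite !ev_join => h; apply: SJ => //; move: sa sb h; clear.
  have [-> | a1] := eqVneq (ev phi a) 0; last by left; auto.
  have [-> | a2] := eqVneq (ev psi a) 0; last by left; auto.
  by rewrite !add0r; right; auto.
rewrite !ev_join.
have [a1|a1] := eqVneq (ev phi a) 0; have [b1|b1] := eqVneq (ev phi b) 0.
- by left; rewrite a1 b1.
- right; case: db => [b0|->]; first by rewrite b0 eqxx in b1.
  have [->//|a2] := eqVneq (ev psi a) 0; case: nS; auto.
- right; case: da => [a0|->]; first by rewrite a0 eqxx in a1.
  have [->//|b2] := eqVneq (ev psi b) 0; case: nS; auto.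
- by case: nS; auto.
Qed.

(** * Full dimensional leaves *)

Lemma size_red H a b : a \in H -> b \in H -> a != b ->
  [/\ size (red1 H a b) = size H, size (red2 H a b) = size H
    & (size (red3 H a b)).+1 = size H].
Proof.
move=> aH bH ab.
have s0 x (s : seq edge) : x \in s -> (size (rem x s)).+1 = size s.
  by move=> xs; rewrite (perm_size (perm_to_rem xs)).
by split; rewrite /= ?s0 ?mem_rem_neq.
Qed.

Lemma leaves_size rule T H X :
  reduction_tree rule H T -> X \in leaves T -> (size X.1 + size X.2 = size H)%N.
Proof.
elim: T H X => [K|a b t2 IH2 t3 IH3 t1 IH1] H X /=.
  by case/andP => /eqP -> _; rewrite inE => /eqP -> /=; rewrite addn0.
case/and5P => aH bH /reducible_neq ab _ /and3P[rt2 rt3 rt1].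
have [s1 s2 s3] := size_red aH bH ab.
rewrite !mem_cat => /or3P[/(IH2 _ _ rt2)|/mapP[Y Yt ->] /=|/(IH1 _ _ rt1)].
- by rewrite s2.
- by rewrite addnS (IH3 _ _ rt3 Yt) s3.
- by rewrite s1.
Qed.

(** Only a step to a middle child loses an edge, so the full dimensional leaves are those reached
    without such a step. *)
Fixpoint full T : seq graph :=
  match T with
  | Leaf L => [:: L]
  | Node _ _ t2 _ t1 => full t2 ++ full t1
  end.

Lemma fullE rule T H : reduction_tree rule H T ->
  full T = [seq F <- [seq X.1 | X <- leaves T] | size F == size H].
Proof.
elim: T H => [K|a b t2 IH2 t3 IH3 t1 IH1] H /=.
  by case/andP => /eqP -> _; rewrite eqxx.
case/and5P => aH bH /reducible_neq ab _ /and3P[rt2 rt3 rt1].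
have [s1 s2 s3] := size_red aH bH ab.
rewrite !map_cat !filter_cat (IH2 _ rt2) (IH1 _ rt1) s1 s2; congr (_ ++ _).
rewrite -map_comp [X in _ = X ++ _](_ : _ = [::]) //.
apply/eqP; rewrite -[_ == _]negbK -has_filter; apply/hasPn => _ /mapP[X Xt ->] /=.
by rewrite -s3 -(leaves_size rt3 Xt) neq_ltn ltnS leq_addr.
Qed.

Lemma fullP rule T H F : reduction_tree rule H T -> F \in full T ->
  (F, [::]) \in leaves T /\ size F = size H.
Proof.
move=> rT; rewrite (fullE rT) mem_filter => /andP[/eqP sF /mapP[[G w] Xt /= eF]].
split=> //; have := leaves_size rT Xt; rewrite /= -eF -sF => /eqP.
by rewrite -{2}[size F]addn0 eqn_add2l size_eq0 => /eqP w0; rewrite eF -w0.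
Qed.

Lemma full_stable rule P T H F :
  stable P -> reduction_tree rule H T -> P H -> F \in full T -> P F.
Proof.
by move=> stP rT PH /(fullP rT)[/(leaves_stable stP rT PH)].
Qed.

(* Reduction trees see a graph only up to reordering its list of edges. *)
Definition canon F : graph := choose (perm_eq F) F.

Lemma canonP F : perm_eq F (canon F).
Proof. exact: chooseP (perm_refl F). Qed.

Lemma canon_eq F K : (canon F == canon K) = perm_eq F K.
Proof.
apply/eqP/idP => [e|FK].
  by apply: perm_trans (canonP F) _; rewrite e perm_sym canonP.
rewrite /canon (@eq_choose _ (perm_eq F) (perm_eq K)).
  by apply: choose_id => //; rewrite perm_sym.
by move=> G; apply/idP/idP; apply: perm_trans; rewrite // perm_sym.
Qed.

(** If [F] has independent edges and [phi] has constant sign on them, [restrict phi F] spans the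
    face of the cone of [F] on the hyperplane [phi] = 0; [crosses] says that this face is a
    facet. *)
Definition restrict phi F : graph := [seq e <- F | ev phi e == 0].
Definition crosses phi F := count (fun e => ev phi e != 0) F == 1%N.

Definition cut (v : nat) e := (src e <= v < tgt e)%N.

(* An edge of a leaf is a path in the root graph, so it crosses [v] only once:
   two edges of the root across [v] lie on different edges of each leaf. *)
Lemma not_crosses rule T H F x y (v : nat) phi :
  good H -> reduction_tree rule H T -> x \in H -> y \in H -> x != y ->
  cut v x -> cut v y -> ev phi x = 1 -> ev phi y = 1 ->
  (forall e, e \in H -> 0 <= ev phi e) -> F \in full T -> ~~ crosses phi F.
Proof.
move=> gH rT xH yH xy vx vy phix phiy phi0 Ft.
have [_ _ [f fP]] := gH.
have [uF _ _] := full_stable good_stable rT gH Ft.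
have pos z : z \in H -> positive (f z) H.
  move=> zH; split=> [e eH|]; first by rewrite fP.
  by exists z; rewrite // fP // eqxx.
have [x0 [e1 e1F x1]] := full_stable (@positive_stable (f _)) rT (pos x xH) Ft.
have [y0 [e2 e2F y2]] := full_stable (@positive_stable (f _)) rT (pos y yH) Ft.
(* [phi - f z] is nonnegative on [H], since [f z] vanishes off [z] and both functionals are 1 at
   [z]; this passes to the leaf. *)
have sub z : z \in H -> ev phi z = 1 -> forall e, e \in F -> ev (f z) e <= ev phi e.
  move=> zH phiz e eF; rewrite -subr_ge0 -evB.
  apply: (full_stable (@nonneg_stable (fun k => phi k - f z k)) rT _ Ft) eF => d dH.
  rewrite evB fP // subr_ge0; have [<-|_] := eqVneq; first by rewrite phiz.
  exact: phi0.
have pe1 : ev phi e1 != 0.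
  by rewrite gt_eqF // (lt_le_trans _ (sub x xH phix e1 e1F)) // lt_def x1 x0.
have pe2 : ev phi e2 != 0.
  by rewrite gt_eqF // (lt_le_trans _ (sub y yH phiy e2 e2F)) // lt_def y2 y0.
have ne12 : e1 != e2.
  have st : stable (fun K => forall e, e \in K -> [/\ True,
      ev (f x) e != 0 \/ ev (f y) e != 0 -> cut v e
    & ev (f x) e = 0 \/ ev (f y) e = 0]).
    apply: disjoint_stable => //= a b /and3P[sa /eqP ab sb] _ _.
      by move=> /andP[_ va] /andP[vb _]; move: va; rewrite ab ltnNge vb.
    rewrite /cut /= => -[|] /andP[h1 h2].
      by rewrite h1 /=; apply: ltn_trans h2 _; rewrite ab.
    by rewrite h2 andbT; apply: leq_trans h1; rewrite -ab ltnW.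
  apply: contraTneq y2 => <-; rewrite negbK.
  have [|_ _ [z|-> //]] := full_stable st rT _ Ft e1 e1F.
    move=> e eH; split=> //; rewrite !fP //.
      by case; rewrite pnatr_eq0 eqb0 negbK => /eqP <-.
    case: (eqVneq x e) => [<-|_]; last by left.
    by right; rewrite eq_sym (negPf xy).
  by rewrite z eqxx in x1.
rewrite /crosses -size_filter neq_ltn; apply/orP; right.
have : uniq [:: e1; e2] by rewrite /= inE ne12.
move/uniq_leq_size; apply => e; rewrite !inE mem_filter.
by case/orP => /eqP ->; apply/andP.
Qed.

(** * Deleting an edge of the root *)

(** For [T] the tree of a middle child: one of the cones triangulating the wall between the two
    outer children is a face of [F]. *)
Definition wall T F := has (fun K => all (mem F) K) (full T).

Lemma wall_perm T F K : perm_eq F K -> wall T F = wall T K.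
Proof.
move=> /perm_mem FK; apply: eq_has => G; apply: eq_all => e /=; exact: FK.
Qed.

(* With [k = true], the full dimensional leaves F together with the vertices i of
   the weights beta_i of P_F.  The flag [k = false] forgets the weights. *)
Fixpoint shell (k : bool) T : seq (graph * seq 'I_n) :=
  match T with
  | Leaf L => [:: (L, [::])]
  | Node a _ t2 t3 t1 => shell k t2 ++
      [seq (X.1, if k && wall t3 X.1 then src a :: X.2 else X.2) | X <- shell k t1]
  end.

Lemma shell_full k T : [seq X.1 | X <- shell k T] = full T.
Proof.
elim: T => //= a b t2 <- t3 _ t1 <-; rewrite map_cat -map_comp.
by congr (_ ++ _); apply: eq_map.
Qed.

Lemma mem_shell k T X : X \in shell k T -> X.1 \in full T.
Proof. by rewrite -(shell_full k); exact: map_f. Qed.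

Section OrderO.
Variables tI tO : rel 'X_{1..m}.
Hypotheses (htI : total_order tI) (htO : total_order tO).
Local Notation ruleO := (@order_O n m tI tO).

Lemma order_O_sub H K p q : {subset K <= H} -> ruleO H p q -> ruleO K p q.
Proof.
move=> KH /and3P[/allP h1 /allP h2 /allP h3]; apply/and3P; split; apply/allP.
- by move=> e /KH /h1 /allP h; apply/allP => e' /KH /h.
- by move=> e /KH /h2.
- by move=> e /KH /h3.
Qed.

(** The rule fixes the middle vertex, then the two outer vertices, then both formal sums by
    antisymmetry of [tI] and [tO]. *)
Lemma order_O_uniq H p q p' q' : ruleO H p q -> ruleO H p' q' ->
  p \in H -> q \in H -> reducible p q ->
  p' \in H -> q' \in H -> reducible p' q' -> p = p' /\ q = q'.
Proof.
move=> /and3P[/allP h1 /allP h2 /allP h3] /and3P[/allP k1 /allP k2 /allP k3].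
move=> pH qH pq p'H q'H pq'.
have [aI _ _] := htI; have [aO _ _] := htO.
have /allP/(_ _ q'H)/implyP/(_ pq') le1 := h1 _ p'H.
have /allP/(_ _ qH)/implyP/(_ pq) le2 := k1 _ pH.
have etp : tgt p = tgt p' by apply: val_inj; apply/eqP; rewrite eqn_leq le1 le2.
have esq : src q = src q'.
  by case/and3P: pq => _ /eqP <- _; case/and3P: pq' => _ /eqP <- _.
have := h2 _ p'H; have := k2 _ pH; have := h3 _ q'H; have := k3 _ qH.
rewrite etp esq !eqxx -!val_eqE /=.
have [//|//|/val_inj eq'] := ltngtP (tgt q') (tgt q).
move=> /= o1 o2.
have [//|//|/val_inj ep'] := ltngtP (src p') (src p).
move=> /= i1 i2.
have fp : fsum p = fsum p' by apply: aI; rewrite i1 i2.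
have fq : fsum q = fsum q' by apply: aO; rewrite o1 o2.
split; [move: etp ep' fp|move: esq eq' fq]; clear.
  by case: p p' => [[? ?] ?] [[? ?] ?]; rewrite /tgt /src /fsum /= => -> -> ->.
by case: q q' => [[? ?] ?] [[? ?] ?]; rewrite /tgt /src /fsum /= => -> -> ->.
Qed.

Definition sourced H (v : 'I_n) := forall e, e \in H -> tgt e != v.

Lemma sourced_stable v : stable (sourced^~ v).
Proof. exact: all_stable. Qed.

(* An edge into [src p] would make [src p] < [tgt p] a vertex with edges on both
   sides. *)
Lemma order_O_sourced H p q : good H -> ruleO H p q -> p \in H -> reducible p q ->
  sourced H (src p).
Proof.
move=> [_ fwd _] /and3P[/allP h _ _] pH /and3P[sp _ _] e eH; apply/eqP => ep.
have /allP/(_ _ pH) := h _ eH; have := fwd _ eH.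
by rewrite /reducible ep eqxx sp => -> /=; rewrite leqNgt sp.
Qed.

Lemma red_rem H K a p q : good H -> a \in H -> p \in H -> q \in H ->
  reducible p q -> a != p -> a != q -> perm_eq K (rem a H) ->
  perm_eq (red1 K p q) (rem a (red1 H p q)) /\
  perm_eq (red2 K p q) (rem a (red2 H p q)).
Proof.
move=> gH aH pH qH pq ap aq KH; have [uH _ _] := gH.
have uK : uniq K by rewrite (perm_uniq KH) rem_uniq.
have /negPf ja : join p q != a.
  by apply: contraNneq (join_notin gH pH qH (reducible_neq pq)) => ->.
have R x : perm_eq (rem x K) (rem a (rem x H)).
  apply: uniq_perm => [||e]; rewrite ?rem_uniq //.
  rewrite (in_rem x e uK) (perm_mem KH) (in_rem a e uH).
  by rewrite (in_rem a e (rem_uniq x uH)) (in_rem x e uH) andbCA.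
by rewrite /red1 /red2 !rem_cons ja !perm_cons.
Qed.

(* A source edge is the first step of every path it lies on, so two source
   edges lie on different edges of each leaf. *)
Lemma sourced_disjoint rule T H F (u v : 'I_n) phi psi :
  reduction_tree rule H T -> sourced H u -> sourced H v ->
  (forall e, e \in H ->
     ev phi e != 0 \/ ev psi e != 0 -> src e = u \/ src e = v) ->
  (forall e, e \in H -> ev phi e = 0 \/ ev psi e = 0) ->
  F \in full T -> forall e, e \in F -> ev phi e = 0 \/ ev psi e = 0.
Proof.
move=> rT Hu Hv sup dis Ft e eF.
have st : stable (fun K => forall e, e \in K -> [/\ tgt e != u /\ tgt e != v,
    ev phi e != 0 \/ ev psi e != 0 -> src e = u \/ src e = v
  & ev phi e = 0 \/ ev psi e = 0]).
  apply: disjoint_stable => //= a b /and3P[_ /eqP ab _] [/eqP au /eqP av] [_ _].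
    by rewrite -ab => _ [].
  by rewrite -ab /src /= => -[|[]].
have [d dH|_ _ //] := full_stable st rT _ Ft e eF.
by split; auto.
Qed.

(** Named so that it can be assumed: the case [k = true] of [shell_restrict] uses it, while its
    proof uses the case [k = false]. *)
Definition wall_spec := forall H p q t1 t3 psi F,
  good H -> p \in H -> q \in H -> reducible p q ->
  reduction_tree ruleO (red1 H p q) t1 -> reduction_tree ruleO (red3 H p q) t3 ->
  ev psi p = 1 -> ev psi q = -1 ->
  (forall e, e \in H -> e != p -> e != q -> ev psi e = 0) ->
  F \in full t1 -> wall t3 F = crosses psi F.

Lemma dual_diff H p q : good H -> p \in H -> q \in H -> p != q ->
  exists psi, [/\ ev psi p = 1, ev psi q = -1
    & forall e, e \in H -> e != p -> e != q -> ev psi e = 0].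
Proof.
move=> [_ _ [f fP]] pH qH pq; exists (fun k => f p k - f q k).
have qp := pq; rewrite eq_sym in qp; split=> [||e eH ep eq]; rewrite evB !fP //.
- by rewrite eqxx (negPf qp) subr0.
- by rewrite eqxx (negPf pq) sub0r.
- by rewrite !(eq_sym _ e) (negPf ep) (negPf eq) subr0.
Qed.

Lemma irreducibleN H p q : p \in H -> q \in H -> reducible p q -> ~ irreducible H.
Proof.
move=> pH qH pq /hasPn/(_ p pH)/negP; apply; apply/hasP; by exists q.
Qed.

(** Induction on [T]. For weights, the source condition excludes [a = q], where the surviving leaves
    lie in [t1] and could gain a factor [src p] that the tree of [K] does not see. *)
Lemma shell_restrict (k : bool) T H T' K a phi : (k -> wall_spec) -> 
  good H -> reduction_tree ruleO H T -> reduction_tree ruleO K T' ->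
  a \in H -> perm_eq K (rem a H) -> ev phi a = 1 ->
  (forall e, e \in K -> ev phi e = 0) -> (k -> sourced H (src a)) ->
  [seq (canon X.1, X.2) | X <- shell k T'] =
  [seq (canon (restrict phi X.1), X.2) | X <- shell k T & crosses phi X.1].
Proof.
move=> ws; elim: T H T' K a => [L|p q t2 IH2 t3 _ t1 IH1] H T' K a gH rT rT'
  aH KH phia phi0 sa.
  have {rT} [/eqP -> irr] := andP rT.
  have HP : perm_eq H (a :: K).
    by apply: perm_trans (perm_to_rem aH) _; rewrite perm_cons perm_sym.
  have KsH e : e \in K -> e \in H by move=> eK; rewrite (perm_mem HP) inE eK orbT.
  (* A subgraph of an irreducible graph is irreducible, so [T'] is a leaf too. *)
  case: T' rT' => [L'|p q t2 t3 t1] /=; last first.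
    by case/and5P => /KsH pK /KsH qK pq; have := irreducibleN pK qK pq.
  case/andP => /eqP -> _.
  have K0 : all (fun e => ev phi e == 0) K by apply/allP => e /phi0 ->.
  have -> : crosses phi H.
    rewrite /crosses (permP HP) /= phia /= add1n eqSS -leqn0 leqNgt -has_count.
    rewrite -all_predC (eq_all (_ : _ =1 (fun e => ev phi e == 0))) // => e /=.
    by rewrite negbK.
  congr [:: (_, _)]; apply/eqP; rewrite canon_eq perm_sym.
  by apply: perm_trans (perm_filter _ HP) _; rewrite /= phia /= (all_filterP K0).
have /and5P[pH qH pq Opq /and3P[rt2 rt3 rt1]] := rT.
have KsH e : e \in K -> e \in H by rewrite (perm_mem KH); apply: mem_rem.
have KH' e : e \in H -> e != a -> e \in K.
  by move=> eH ea; rewrite (perm_mem KH) mem_rem_neq.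
have phi_ge0 e : e \in H -> 0 <= ev phi e.
  by move=> eH; have [->|/(KH' _ eH)/phi0 ->] := eqVneq e a; rewrite ?phia.
have [uH fwdH _] := gH.
have pqn := reducible_neq pq.
have jH := join_notin gH pH qH pqn.
have nj x : x \in H -> x != join p q by move=> xH; apply: contraNneq jH => <-.
have g1 := good_red1 gH pH qH pq; have g2 := good_red2 gH pH qH pq.
have sj v : sourced H v -> sourced (red1 H p q) v /\ sourced (red2 H p q) v.
  by case/(sourced_stable pH qH pq).
have [m1 m2 _] : [/\ forall e, e \in red1 H p q -> 0 <= ev phi e,
    forall e, e \in red2 H p q -> 0 <= ev phi e & _] :=
  nonneg_stable pH qH pq phi_ge0.
have /and3P[lt_p /eqP epq lt_q] := pq.
(* If [a = p], then [red1] contains [a] and [join a q], which start at the same vertex and have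
   [phi] = 1, so no leaf of [t1] crosses; [red2] without [join a q] is [K]. *)
have [ap|ap] := eqVneq a p.
  rewrite -ap in pH pq Opq rt2 rt3 rt1 pqn jH nj g1 g2 sj m1 m2 lt_p epq *.
  have qa : q != a by rewrite eq_sym.
  have phij : ev phi (join a q) = 1 by rewrite ev_join phia phi0 ?addr0 // KH'.
  have KR : perm_eq K (rem (join a q) (red2 H a q)) by rewrite /red2 rem_cons eqxx.
  have E2 := IH2 _ T' K (join a q) g2 rt2 rT' (mem_head _ _) KR phij phi0
    (fun hk => proj2 (sj _ (sa hk))).
  rewrite E2.
  rewrite /= filter_cat map_cat [X in _ = _ ++ map _ X](_ : _ = [::]) ?cats0 //.
  apply/eqP; rewrite -[_ == _]negbK -has_filter; apply/hasPn => _ /mapP[X Xt ->] /=.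
  apply: (@not_crosses _ _ _ _ a (join a q) (src a) phi g1 rt1 _ _ (nj _ pH)) => //.
  - by rewrite /red1 inE mem_rem_neq ?orbT.
  - exact: mem_head.
  - by rewrite /cut leqnn.
  - by rewrite /cut /= leqnn (reducible_join_lt pq).
  - exact: mem_shell Xt.
(* The mirror case: [t2] drops out and [red1] without [join p a] is [K]. Here [p] ends at [src a],
   which forces [k = false]. *)
have [aq|aq] := eqVneq a q.
  have kF : k = false.
    by case: (k) sa => // /(_ isT p pH); rewrite aq epq eqxx.
  rewrite kF /= in IH1 sa *.
  rewrite -aq in qH pq Opq rt2 rt3 rt1 pqn jH nj g1 g2 sj m1 m2 lt_q epq *.
  have phij : ev phi (join p a) = 1.
    by rewrite ev_join phia phi0 ?add0r // KH' // eq_sym.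
  have KR : perm_eq K (rem (join p a) (red1 H p a)) by rewrite /red1 rem_cons eqxx.
  have E1 := IH1 _ T' K (join p a) g1 rt1 rT' (mem_head _ _) KR phij phi0
    (fun hk => match notF hk with end).
  rewrite /= filter_cat map_cat [X in _ = map _ X ++ _](_ : _ = [::]) /=; last first.
    apply/eqP; rewrite -[_ == _]negbK -has_filter; apply/hasPn => X Xt.
    apply: (@not_crosses _ _ _ _ a (join p a) (src a) phi g2 rt2 _ _ (nj _ qH)) => //.
    - by rewrite /red2 inE mem_rem_neq ?orbT.
    - exact: mem_head.
    - by rewrite /cut leqnn.
    - by rewrite /cut /= -epq ltnW //= epq.
    - exact: mem_shell Xt.
  by rewrite E1 filter_map -map_comp.
(* Now [p] and [q] both survive in [K], and by uniqueness [T'] starts with the same reduction. *)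
have pK := KH' _ pH; rewrite eq_sym ap in pK; have {}pK := pK isT.
have qK := KH' _ qH; rewrite eq_sym aq in qK; have {}qK := qK isT.
case: T' rT' => [L'|p' q' t2' t3' t1'] /=.
  by case/andP => _ irr; have := irreducibleN pK qK pq.
case/and5P => pK' qK' pq' Opq' /and3P[rt2' rt3' rt1'].
have [] := order_O_uniq (order_O_sub KsH Opq) Opq' pK qK pq pK' qK' pq'.
move=> ? ?; subst p' q'; clear pK' qK' pq'.
have [K1 K2] := red_rem gH aH pH qH pq ap aq KH.
have phiR e : e \in red1 K p q \/ e \in red2 K p q -> ev phi e = 0.
  have [h1 h2 _] := mem_red K p q e; move=> h.
  have : e = join p q \/ e \in K by case: h.
  by case=> [->|/phi0 //]; rewrite ev_join !phi0 ?addr0.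
have a1 : a \in red1 H p q by rewrite inE mem_rem_neq ?orbT.
have a2 : a \in red2 H p q by rewrite inE mem_rem_neq ?orbT.
have E2 := IH2 _ t2' _ a g2 rt2 rt2' a2 K2 phia
  (fun e h => phiR e (or_intror h)) (fun hk => proj2 (sj _ (sa hk))).
have E1 := IH1 _ t1' _ a g1 rt1 rt1' a1 K1 phia
  (fun e h => phiR e (or_introl h)) (fun hk => proj1 (sj _ (sa hk))).
rewrite map_cat filter_cat map_cat E2; congr (_ ++ _).
(* The weight update sees a graph only up to reordering, so it may be applied after [canon]. *)
pose upd (X : graph * seq 'I_n) :=
  (X.1, if k && wall t3' X.1 then src p :: X.2 else X.2).
transitivity [seq upd X | X <- [seq (canon X.1, X.2) | X <- shell k t1']].
  rewrite -!map_comp; apply: eq_map => X /=.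
  by rewrite /upd /= -(wall_perm _ (canonP _)).
rewrite E1 -map_comp filter_map -map_comp.
apply/eq_in_map => X; rewrite mem_filter => /andP[Xc Xt] /=.
rewrite /upd /=; congr (_, _).
case hk : k => //=; rewrite hk in Xt E1 ws sa.
suff -> : wall t3' (canon (restrict phi X.1)) = wall t3 X.1 by [].
have [psi [psip psiq psi0]] := dual_diff gH pH qH pqn.
have gK : good K by apply: good_sub gH; rewrite ?(perm_uniq KH) ?rem_uniq.
have Ft := mem_shell Xt.
rewrite (ws isT H p q t1 t3 psi) //.
have : (canon (restrict phi X.1), X.2) \in
    [seq (canon X.1, X.2) | X <- shell true t1'].
  by rewrite E1; apply/mapP; exists X; rewrite // mem_filter Xc.
case/mapP => Y Yt [/eqP + _]; rewrite canon_eq => XY.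
rewrite -(wall_perm _ (canonP _)) (wall_perm _ XY).
rewrite (ws isT K p q t1' t3' psi) //; first last.
- exact: mem_shell Yt.
- by move=> e /KsH; exact: psi0.
(* Dropping the edges with [phi] nonzero does not change the count for [psi]: the two supports start
   on distinct edges leaving the sources [src a] and [src p], and stay disjoint. *)
rewrite /crosses -(permP XY) count_filter; congr (_ == _).
apply: eq_in_count => e eF /=.
have [sa1 _] := sj _ (sa isT).
have [sp1 _] := sj _ (order_O_sourced gH Opq pH pq).
have evj : ev phi (join p q) = 0 /\ ev psi (join p q) = 0.
  by rewrite !ev_join psip psiq subrr !phi0 ?addr0.
have val d : d \in red1 H p q -> [\/ d = a, d = p | ev phi d = 0 /\ ev psi d = 0].
  rewrite inE => /predU1P[->|]; first by constructor 3.
  rewrite (in_rem q d uH) => /andP[dq dH].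
  have [->|da] := eqVneq d a; first by constructor 1.
  have [->|dp] := eqVneq d p; first by constructor 2.
  by constructor 3; rewrite psi0 // phi0 // KH'.
case: (sourced_disjoint (phi := phi) (psi := psi) rt1 sa1 sp1 _ _ Ft eF) =>
  [d|d|->|->].
- by case/val => [->|->|[-> ->]]; [left|right|rewrite eqxx => -[]].
- by case/val => [->|->|[-> ->]]; [right; apply: psi0|left; apply: phi0|left].
- by rewrite eqxx andbT.
- by rewrite eqxx.
Qed.

(** The weight-free form, applied below to [p] in [red1] and to [q] in [red2]. *)
Lemma full_restrict T H T' K a phi :
  good H -> reduction_tree ruleO H T -> reduction_tree ruleO K T' ->
  a \in H -> perm_eq K (rem a H) -> ev phi a = 1 ->
  (forall e, e \in K -> ev phi e = 0) ->
  [seq canon F | F <- full T'] =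
  [seq canon (restrict phi F) | F <- full T & crosses phi F].
Proof.
move=> gH rT rT' aH KH phia phi0.
have := congr1 (map fst) (@shell_restrict false T H T' K a phi
  (fun h => match notF h with end) gH rT rT' aH KH phia phi0
  (fun h => match notF h with end)).
by rewrite -(shell_full false) -(shell_full false T) filter_map -!map_comp.
Qed.

(** * Facets shared by leaves of the two outer children *)

Lemma count_restrict phi F :
  (size (restrict phi F) + count (fun e => ev phi e != 0) F)%N = size F.
Proof. by rewrite size_filter count_predC. Qed.

Lemma positive_count phi F :
  positive phi F -> (0 < count (fun e => ev phi e != 0) F)%N.
Proof. by case=> _ [e eF he]; rewrite -has_count; apply/hasP; exists e. Qed.

(* [psi] is 0 on the wall common to the cones of red1 and red2, nonnegative on the
   first cone and nonpositive on the second. *)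
Section Node.
Variables (H : graph) (p q : edge) (t1 t2 t3 : rtree) (psi : 'I_m -> int).
Hypotheses (gH : good H) (pH : p \in H) (qH : q \in H) (pq : reducible p q).
Hypothesis rt2 : reduction_tree ruleO (red2 H p q) t2.
Hypothesis rt3 : reduction_tree ruleO (red3 H p q) t3.
Hypothesis rt1 : reduction_tree ruleO (red1 H p q) t1.
Hypotheses (psip : ev psi p = 1) (psiq : ev psi q = -1).
Hypothesis psi0 : forall e, e \in H -> e != p -> e != q -> ev psi e = 0.

Let npsi k := - psi k.

Let evN e : ev npsi e = - ev psi e.
Proof. by rewrite -sumrN; apply: eq_bigr => k _; rewrite mulNr. Qed.

Let evj : ev psi (join p q) = 0.
Proof. by rewrite ev_join psip psiq subrr. Qed.

Lemma psi_red3 e : e \in red3 H p q -> ev psi e = 0.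
Proof.
have [uH _ _] := gH.
rewrite inE => /predU1P[->//|]; rewrite (in_rem _ _ (rem_uniq q uH)).
by rewrite (in_rem _ _ uH) => /and3P[ep eq eH]; exact: psi0.
Qed.

Lemma positive_red1 X : X \in leaves t1 -> positive psi X.1.
Proof.
apply: leaves_stable (@positive_stable psi) rt1 _ X; split; last first.
  by exists p; rewrite ?psip // inE mem_rem_neq ?orbT // reducible_neq.
have [uH _ _] := gH.
move=> e; rewrite inE => /predU1P[->|]; first by rewrite evj.
rewrite (in_rem _ _ uH) => /andP[eq eH].
by have [->|ep] := eqVneq e p; rewrite ?psip // psi0.
Qed.

Lemma negative_red2 X : X \in leaves t2 -> positive npsi X.1.
Proof.
apply: leaves_stable (@positive_stable npsi) rt2 _ X; split; last first.
  exists q; first by rewrite inE mem_rem_neq ?orbT // eq_sym reducible_neq.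
  by rewrite evN psiq.
have [uH _ _] := gH.
move=> e; rewrite evN inE => /predU1P[->|]; first by rewrite evj.
rewrite (in_rem _ _ uH) => /andP[ep eH].
by have [->|eq] := eqVneq e q; rewrite ?psiq // psi0.
Qed.

Lemma vanish_red3 X : X \in leaves t3 -> forall e, e \in X.1 -> ev psi e = 0.
Proof. exact: leaves_stable (@vanish_stable psi) rt3 psi_red3 X. Qed.

(** The sign of [psi] keeps the leaves of the three subtrees apart, so that [weight] looks up a leaf
    in the right subtree. *)
Lemma sep12 X Y : X \in leaves t1 -> Y \in leaves t2 -> ~~ perm_eq X.1 Y.1.
Proof.
move=> /positive_red1[X0 [e eX pe]] /negative_red2[Y0 _].
apply: contra pe => /perm_mem XY; rewrite eq_le X0 // andbT -oppr_ge0 -evN Y0 //.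
by rewrite -XY.
Qed.

Lemma sep13 X Y : X \in leaves t1 -> Y \in leaves t3 -> ~~ perm_eq X.1 Y.1.
Proof.
move=> /positive_red1[X0 [e eX pe]] /vanish_red3 Y0.
by apply: contra pe => /perm_mem XY; rewrite Y0 // -XY.
Qed.

Lemma sep23 X Y : X \in leaves t2 -> Y \in leaves t3 -> ~~ perm_eq X.1 Y.1.
Proof.
move=> /negative_red2[X0 [e eX pe]] /vanish_red3 Y0.
by apply: contra pe => /perm_mem XY; rewrite evN Y0 ?oppr0 // -XY.
Qed.

Lemma full_restrict1 : [seq canon F | F <- full t3] =
  [seq canon (restrict psi F) | F <- full t1 & crosses psi F].
Proof.
apply: full_restrict (good_red1 gH pH qH pq) rt1 rt3 _ _ psip psi_red3.
  by rewrite inE mem_rem_neq ?orbT // reducible_neq.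
by rewrite red3_red1.
Qed.

Lemma full_restrict2 : [seq canon F | F <- full t3] =
  [seq canon (restrict psi F) | F <- full t2 & crosses psi F].
Proof.
(* In [red2] the deleted edge is [q], where [psi] is -1; the opposite functional has the same
   zeros. *)
rewrite (@full_restrict t2 (red2 H p q) t3 (red3 H p q) q npsi) //.
- rewrite (eq_filter (_ : crosses npsi =1 crosses psi)) => [|F].
    by apply: eq_map => F; congr canon; apply: eq_filter => e; rewrite evN oppr_eq0.
  by congr (_ == _); apply: eq_count => e; rewrite evN oppr_eq0.
- exact: good_red2.
- by rewrite inE mem_rem_neq ?orbT // eq_sym reducible_neq.
- exact: red3_red2.
- by rewrite evN psiq opprK.
- by move=> e /psi_red3 h; rewrite evN h oppr0.
Qed.

(** A full leaf of [t3] inside [F] accounts for all but one of its edges, with [psi] = 0, and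
    positivity puts the last one off the wall. The converse is [full_restrict1]. *)
Lemma wall_crosses F : F \in full t1 -> wall t3 F = crosses psi F.
Proof.
move=> Ft; have [Fl sF] := fullP rt1 Ft.
apply/idP/idP => [/hasP[G Gt /allP GF]|cF].
  have [Gl sG] := fullP rt3 Gt.
  have [uG _ _] := full_stable good_stable rt3 (good_red3 gH pH qH pq) Gt.
  have [s1 _ s3] := size_red pH qH (reducible_neq pq).
  have : (size G <= size (restrict psi F))%N.
    apply: uniq_leq_size => // e eG; have eF : e \in F := GF e eG.
    by rewrite mem_filter eF (vanish_red3 Gl eG) eqxx.
  move=> le; rewrite /crosses eqn_leq (positive_count (positive_red1 Fl)) andbT.
  by rewrite -(leq_add2l (size (restrict psi F))) count_restrict addn1 sF s1 -s3 -sG.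
have : canon (restrict psi F) \in [seq canon F | F <- full t3].
  by rewrite full_restrict1; apply/mapP; exists F; rewrite // mem_filter cF.
case/mapP => G Gt /eqP; rewrite canon_eq => /perm_mem FG.
apply/hasP; exists G => //; apply/allP => e; rewrite -FG mem_filter => /andP[_].
by [].
Qed.

Lemma common_restrict F F' :
  F \in full t1 -> F' \in full t2 ->
  common F F' = [seq e <- restrict psi F | e \in F'].
Proof.
move=> /(fullP rt1)[/positive_red1[F0 _] _] /(fullP rt2)[/negative_red2[F'0 _] _].
rewrite -filter_predI; apply: eq_in_filter => e eF /=.
case eF' : (e \in F') => //=; rewrite eq_le (F0 e eF) andbT.
by rewrite -oppr_ge0 -evN F'0.
Qed.

(** The common edges lie in both restrictions, and each restriction lacks at least one edge of its
    leaf; if only one edge of [F] is not common, both restrictions equal the common part. *)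
Lemma common_facet F F' : F \in full t1 -> F' \in full t2 ->
  ((size (common F F')).+1 == size F) =
  [&& crosses psi F, crosses psi F' & perm_eq (restrict psi F') (restrict psi F)].
Proof.
move=> Ft F't; rewrite common_restrict //.
have [Fl sF] := fullP rt1 Ft; have [F'l sF'] := fullP rt2 F't.
have [s1 s2 _] := size_red pH qH (reducible_neq pq).
have sFF' : size F' = size F by rewrite sF sF' s1 s2.
have g1 := good_red1 gH pH qH pq; have g2 := good_red2 gH pH qH pq.
have [uF _ _] := full_stable good_stable rt1 g1 Ft.
have [uF' _ _] := full_stable good_stable rt2 g2 F't.
have cF := count_restrict psi F; have cF' := count_restrict psi F'.
have F_gt0 := positive_count (positive_red1 Fl).
have F'_gt0 : (0 < count (fun e => ev psi e != 0) F')%N.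
  have := positive_count (negative_red2 F'l).
  rewrite (eq_count (_ : _ =1 (fun e => ev psi e != 0))) // => e.
  by rewrite evN oppr_eq0.
have sr G : (size (restrict psi G)).+1 = size G -> crosses psi G.
  by move/eqP; rewrite -(count_restrict psi G) -addn1 eqn_add2l eq_sym.
have crs G : crosses psi G -> (size (restrict psi G)).+1 = size G.
  by move/eqP => c1; rewrite -(count_restrict psi G) c1 addn1.
have rlt G : (0 < count (fun e => ev psi e != 0) G)%N ->
    (size (restrict psi G) < size G)%N.
  by move=> c; rewrite -(count_restrict psi G) -addn1 leq_add2l.
apply/eqP/and3P => [sc|[cr cr' rr]].
  have le : (size [seq e <- restrict psi F | e \in F'] <= size (restrict psi F))%N.
    by rewrite size_filter count_size.
  have srF : (size (restrict psi F)).+1 = size F.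
    by apply/eqP; rewrite eqn_leq rlt // -sc ltnS le.
  have allF' : all (mem F') (restrict psi F).
    by rewrite all_count -size_filter; apply/eqP; apply: succn_inj; rewrite srF.
  have sub : {subset restrict psi F <= restrict psi F'}.
    move=> e eF; have eF' : e \in F' := allP allF' e eF.
    by move: eF; rewrite !mem_filter eF' andbT => /andP[].
  have ur : uniq (restrict psi F) by rewrite filter_uniq.
  have ur' : uniq (restrict psi F') by rewrite filter_uniq.
  have le' : (size (restrict psi F') <= size (restrict psi F))%N.
    by rewrite -ltnS srF -sFF' rlt.
  have [es ms] := uniq_min_size ur sub le'.
  split; [exact: sr|by apply: sr; rewrite -es srF sFF'|].
  by rewrite perm_sym; exact: uniq_perm.
rewrite (all_filterP _) ?crs //; apply/allP => e.
by rewrite -(perm_mem rr) mem_filter => /andP[].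
Qed.

Lemma common_perm F F' : F \in full t1 -> F' \in full t2 ->
  (size (common F F')).+1 == size F -> perm_eq (restrict psi F) (common F F').
Proof.
move=> Ft F't; rewrite common_facet // common_restrict // => /and3P[_ _ rr].
rewrite (all_filterP _) //; apply/allP => e.
by rewrite -(perm_mem rr) mem_filter => /andP[].
Qed.

(** The restrictions of the crossing leaves on either side list the full leaves of [t3], each once,
    so a crossing [F] has exactly one partner in [t2]. *)
Lemma count_facets F : uniq [seq canon G | G <- full t3] -> F \in full t1 ->
  count (fun F' => (size (common F F')).+1 == size F) (full t2) = crosses psi F.
Proof.
move=> u3 Ft; set c := count _ _.
have -> : c = count (fun F' => [&& crosses psi F, crosses psi F' &
    perm_eq (restrict psi F') (restrict psi F)]) (full t2).
  by apply: eq_in_count => F' F't; exact: common_facet.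
case cF : (crosses psi F) => /=; last exact: count_pred0.
have -> : count (fun F' => crosses psi F' &&
    perm_eq (restrict psi F') (restrict psi F)) (full t2) =
    count_mem (canon (restrict psi F))
      [seq canon (restrict psi F') | F' <- full t2 & crosses psi F'].
  rewrite count_map count_filter; apply: eq_count => F' /=.
  by rewrite canon_eq andbC.
rewrite -full_restrict2 count_uniq_mem // full_restrict1.
by apply/eqP; rewrite eqb1; apply/mapP; exists F; rewrite // mem_filter cF.
Qed.

(** * Weights of leaves below a node *)

Definition is_leaf T Q :=
  has (fun X : graph * seq 'I_n => perm_eq X.1 Q) (leaves T).

Lemma leaf_paths0 T Q :
  (forall X, X \in leaves T -> ~~ perm_eq X.1 Q) ->
  [seq X <- leaves T | perm_eq X.1 Q] = [::].
Proof.
by move=> h; apply/eqP; rewrite -[_ == _]negbK -has_filter; apply/hasPn.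
Qed.

Lemma leaf_paths_neq0 T Q : is_leaf T Q ->
  exists X s, [/\ [seq X <- leaves T | perm_eq X.1 Q] = X :: s, X \in leaves T
                & perm_eq X.1 Q].
Proof.
rewrite /is_leaf has_filter; case E : filter => [//|X s] _; exists X, s.
have : X \in [seq X <- leaves T | perm_eq X.1 Q] by rewrite E mem_head.
by rewrite mem_filter => /andP[].
Qed.

Local Notation T := (Node p q t2 t3 t1).

(** [weight] reads the first matching leaf, and the leaves of [t2] come first. *)
Lemma weight2 Q : is_leaf t2 Q -> is_leaf T Q /\ weight T Q = weight t2 Q.
Proof.
move=> /leaf_paths_neq0[X [s [E Xt XQ]]]; split.
  by apply/hasP; exists X; rewrite // mem_cat Xt.
by rewrite /weight /= filter_cat E.
Qed.

Lemma weight1 Q : is_leaf t1 Q -> is_leaf T Q /\ weight T Q = weight t1 Q.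
Proof.
move=> /leaf_paths_neq0[X [s [E Xt XQ]]]; split.
  by apply/hasP; exists X; rewrite // !mem_cat Xt !orbT.
rewrite /weight /= !filter_cat !map_cat leaf_paths0 => [|Y Yt]; last first.
  apply: contra (sep12 Xt Yt) => YQ; apply: perm_trans XQ _.
  by rewrite perm_sym.
rewrite filter_map leaf_paths0 // => Y Yt.
apply: contra (sep13 Xt Yt) => /= YQ; apply: perm_trans XQ _.
by rewrite perm_sym.
Qed.

Lemma weight3 F Q : F \in full t1 -> crosses psi F ->
  perm_eq (restrict psi F) Q -> is_leaf T Q /\ weight T Q = 'X_(src p).
Proof.
move=> Ft cF FQ.
have : canon (restrict psi F) \in [seq canon F | F <- full t3].
  by rewrite full_restrict1; apply/mapP; exists F; rewrite // mem_filter cF.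
case/mapP => G Gt /eqP; rewrite canon_eq => FG; have [Gl sG] := fullP rt3 Gt.
have GQ : perm_eq G Q by apply: perm_trans FQ; rewrite perm_sym.
have Q3 : is_leaf t3 Q by apply/hasP; exists (G, [::]).
have [X [s [E Xt XQ]]] := leaf_paths_neq0 Q3.
split.
  apply/hasP; exists (X.1, src p :: X.2) => //.
  rewrite !mem_cat (map_f (fun X : graph * seq 'I_n => (X.1, src p :: X.2)) Xt).
  by rewrite orbT.
rewrite /weight /= !filter_cat !map_cat leaf_paths0 => [|Y Yt]; last first.
  apply: contra (sep23 Yt Xt) => YQ; apply: perm_trans YQ _.
  by rewrite perm_sym.
rewrite filter_map (eq_filter (_ : _ =1 (fun X => perm_eq X.1 Q))) // E /=.
(* [X] has as many edges as the root of [t3], so its own list of middle steps is empty and the node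
   contributes the only one. *)
have := leaves_size rt3 Xt; rewrite -sG (perm_size XQ) (perm_size GQ) => /eqP.
by rewrite -{2}[size Q]addn0 eqn_add2l size_eq0 => /eqP ->.
Qed.

Lemma prod_facets F : uniq [seq canon G | G <- full t3] -> F \in full t1 ->
  let P := [seq Q <- [seq common F F' | F' <- full t2] | (size Q).+1 == size F] in
  all (is_leaf T) P /\
  \prod_(Q <- P) weight T Q = if crosses psi F then 'X_(src p) else 1.
Proof.
move=> u3 Ft P.
have PF Q : Q \in P -> is_leaf T Q /\ weight T Q = 'X_(src p).
  rewrite mem_filter => /andP[sQ /mapP[F' F't QE]].
  rewrite QE in sQ *.
  have := sQ; rewrite common_facet // => /and3P[cF _ _].
  by apply: (weight3 Ft cF); exact: common_perm.
split; first by apply/allP => Q /PF[].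
have : size P = crosses psi F.
  by rewrite /P filter_map size_map size_filter; exact: count_facets.
move: PF; case: P => [|Q [|Q' s]] PF; case: crosses => //= _.
  by rewrite big_nil.
by rewrite big_seq1; have [] := PF Q (mem_head _ _).
Qed.

End Node.

Lemma wall_specP : wall_spec.
Proof.
move=> H p q t1 t3 psi F gH pH qH pq rt1 rt3 psip psiq psi0 Ft.
exact: (wall_crosses gH pH qH pq rt3 rt1 psip psiq psi0 Ft).
Qed.

Lemma full_uniq T H : good H -> reduction_tree ruleO H T ->
  uniq [seq canon F | F <- full T].
Proof.
elim: T H => // p q t2 IH2 t3 _ t1 IH1 H gH.
case/and5P => pH qH pq _ /and3P[rt2 rt3 rt1].
have [psi [psip psiq psi0]] := dual_diff gH pH qH (reducible_neq pq).
rewrite /= map_cat cat_uniq (IH2 _ (good_red2 gH pH qH pq) rt2).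
rewrite (IH1 _ (good_red1 gH pH qH pq) rt1) andbT /=.
apply/hasPn => _ /mapP[F /(fullP rt1)[Fl _] ->]; apply/mapP => -[F'].
move=> /(fullP rt2)[F'l _] /eqP; rewrite canon_eq.
by apply/negP; have := sep12 gH pH qH pq rt2 rt1 psip psiq psi0 Fl F'l.
Qed.

(** * The two sides of the identity *)

Definition shell_sum T : {mpoly int[n]} :=
  \sum_(X <- shell true T) \prod_(i <- X.2) 'X_i.

Lemma leaves_shell_sum T H : good H -> reduction_tree ruleO H T ->
  \sum_(X <- leaves T) \prod_(i <- X.2) ('X_i - 1) = shell_sum T.
Proof.
rewrite /shell_sum; elim: T H => [L|p q t2 IH2 t3 IH3 t1 IH1] H gH.
  by rewrite !big_seq1 !big_nil.
case/and5P => pH qH pq Opq /and3P[rt2 rt3 rt1].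
have g1 := good_red1 gH pH qH pq; have g3 := good_red3 gH pH qH pq.
have [psi [psip psiq psi0]] := dual_diff gH pH qH (reducible_neq pq).
have psi3 := psi_red3 gH psip psiq psi0.
rewrite /= !big_cat !big_map /= (IH2 _ (good_red2 gH pH qH pq) rt2); congr (_ + _).
under eq_bigr do rewrite big_cons.
rewrite -big_distrr /= (IH3 _ g3 rt3) (IH1 _ g1 rt1).
(* [red3] is [red1] without [p], and the order makes [src p] a source, so the weighted deletion
   statement applies. *)
have -> : \sum_(X <- shell true t3) \prod_(i <- X.2) 'X_i =
    \sum_(X <- shell true t1 | crosses psi X.1) \prod_(i <- X.2) 'X_i :> {mpoly int[n]}.
  rewrite -(big_map snd xpredT (fun s => \prod_(i <- s) 'X_i)).
  have -> : [seq X.2 | X <- shell true t3] =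
      [seq X.2 | X <- shell true t1 & crosses psi X.1].
    have p1 : p \in red1 H p q by rewrite inE mem_rem_neq ?orbT // reducible_neq.
    have K1 : perm_eq (red3 H p q) (rem p (red1 H p q)) by rewrite red3_red1.
    have [sp _ _] := sourced_stable pH qH pq (order_O_sourced gH Opq pH pq).
    have := congr1 (map snd) (@shell_restrict true t1 _ t3 _ p psi
      (fun=> wall_specP) g1 rt1 rt3 p1 K1 psip psi3 (fun=> sp)).
    by rewrite -!map_comp.
  by rewrite big_map big_filter.
(* Leaf by leaf in [t1]: a crossing leaf gets (beta - 1) + 1 = beta as extra factor, any other leaf
   gets 1. *)
rewrite big_mkcond big_distrr -big_split big_seq [RHS]big_seq.
apply: eq_bigr => X /mem_shell Xt.
rewrite /= (wall_crosses gH pH qH pq rt3 rt1 psip psiq psi0 Xt).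
case: crosses; last by rewrite mulr0 add0r.
by rewrite big_cons mulrBl mul1r subrK.
Qed.

Lemma full_leavesE T H : size H = m -> reduction_tree ruleO H T ->
  full_leaves T = full T.
Proof. by move=> sH rT; rewrite (fullE rT) sH. Qed.

Lemma facets_shell T H i : good H -> size H = m -> reduction_tree ruleO H T ->
  (i < size (full T))%N ->
  all (is_leaf T) (facets T i) /\
  \prod_(Q <- facets T i) weight T Q =
    \prod_(j <- (nth ([::], [::]) (shell true T) i).2) 'X_j.
Proof.
elim: T H i => [L|p q t2 IH2 t3 _ t1 IH1] H i gH sH rT.
  by rewrite /facets (full_leavesE sH rT); case: i => // _; rewrite /= !big_nil.
rewrite /facets (full_leavesE sH rT).
have /and5P[pH qH pq Opq /and3P[rt2 rt3 rt1]] := rT.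
have g1 := good_red1 gH pH qH pq; have g2 := good_red2 gH pH qH pq.
have [s1 s2 _] := size_red pH qH (reducible_neq pq).
rewrite sH in s1 s2.
have [psi [psip psiq psi0]] := dual_diff gH pH qH (reducible_neq pq).
rewrite /= size_cat nth_cat take_cat nth_cat.
have ss t : size (shell true t) = size (full t).
  by rewrite -(shell_full true) size_map.
rewrite ss => lt_ia; case: (ltnP i (size (full t2))) => [lt_i|le_i].
  have [] := IH2 _ i g2 s2 rt2 lt_i; rewrite /facets (full_leavesE s2 rt2).
  move=> /allP l2 <-; split; first by apply/allP => Q /l2 /(@weight2 p q t1 t2 t3)[].
  by rewrite big_seq [RHS]big_seq; apply: eq_bigr => Q /l2 /(@weight2 p q t1 t2 t3)[].
(* Leaf [j] of [t1] is preceded by all leaves of [t2], which contribute the wall factor; the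
   preceding leaves of [t1] are covered by induction. *)
set j := (i - size (full t2))%N.
have lt_j : (j < size (full t1))%N by rewrite ltn_subLR.
have Ft : nth [::] (full t1) j \in full t1 by exact: mem_nth.
have [] := IH1 _ j g1 s1 rt1 lt_j; rewrite /facets (full_leavesE s1 rt1).
set F := nth _ _ _ in Ft *.
move=> /allP l1 pr1.
have u3 := full_uniq (good_red3 gH pH qH pq) rt3.
have [al2 pr2] := prod_facets gH pH qH pq rt2 rt3 rt1 psip psiq psi0 u3 Ft.
rewrite map_cat filter_cat all_cat big_cat al2 pr2 /=; split.
  apply/allP => Q /l1.
  by case/(weight1 gH pH qH pq rt2 rt3 rt1 psip psiq psi0).
have -> : \prod_(Q <- [seq Q <- [seq common F F' | F' <- take j (full t1)]
    | (size Q).+1 == size F]) weight (Node p q t2 t3 t1) Q =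
    \prod_(k <- (nth ([::], [::]) (shell true t1) j).2) 'X_k.
  rewrite -pr1 big_seq [RHS]big_seq; apply: eq_bigr => Q /l1.
  by case/(weight1 gH pH qH pq rt2 rt3 rt1 psip psiq psi0).
rewrite (nth_map ([::], [::])) ?ss //=.
have -> : (nth ([::], [::]) (shell true t1) j).1 = F.
  by rewrite /F -(shell_full true) (nth_map ([::], [::])) ?ss.
rewrite (wall_crosses gH pH qH pq rt3 rt1 psip psiq psi0 Ft).
by case: crosses; rewrite ?big_cons ?mul1r.
Qed.

Lemma h_poly_shell T H : good H -> size H = m -> reduction_tree ruleO H T ->
  h_poly T = shell_sum T.
Proof.
move=> gH sH rT; rewrite /h_poly /shell_sum (big_nth ([::], [::])) big_mkord.
have -> : size (shell true T) = size (full_leaves T).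
  by rewrite (full_leavesE sH rT) -(shell_full true) size_map.
apply: eq_bigr => i _.
have lt_i : (i < size (full T))%N by rewrite -(full_leavesE sH rT).
by have [] := facets_shell gH sH rT lt_i.
Qed.

(** Every summand is a monomial with coefficient 1. *)
Lemma shell_sum_ge0 T (u : 'X_{1..n}) : 0 <= (shell_sum T)@_u.
Proof.
rewrite /shell_sum raddf_sum; apply: sumr_ge0 => X _ /=.
have -> : \prod_(i <- X.2) 'X_i = 'X_[\sum_(i <- X.2) U_(i)]%MM :> {mpoly int[n]}.
  by rewrite (big_morph _ (@mpolyXD n int) (@mpolyX0 n int)).
by rewrite mcoeffX.
Qed.

Lemma shifted_reduced_formE T : shifted_reduced_form T =
  \sum_(X <- leaves T) \prod_(i <- X.2) ('X_i - 1).
Proof.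
rewrite /shifted_reduced_form /reduced_form.
rewrite (raddf_sum (meval (fun=> 1))) (raddf_sum (comp_mpoly _)).
apply: eq_bigr => X _ /=.
rewrite mevalZ rmorph_prod /= [X in _ * X]big1 => [|e _]; last by rewrite mevalXU.
rewrite mulr1 rmorph_prod /=; apply: eq_bigr => i _.
by rewrite comp_mpolyXU -tnth_nth tnth_mktuple.
Qed.

Lemma good_root (G : m.-tuple ('I_n * 'I_n)) :
  (forall k : 'I_m, ((tnth G k).1 < (tnth G k).2)%N) -> good (root_graph G).
Proof.
have Uinj : injective (fun k : 'I_m => (tnth G k, U_(k)%MM)).
  by move=> k l /(congr1 snd)/mnmP kl; have := kl k; rewrite !mnm1E eqxx; case: eqP.
move=> hG; split.
- by rewrite map_inj_uniq ?enum_uniq.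
- by move=> e /mapP[k _ ->]; exact: hG.
(* The formal sums of the root edges are the unit vectors, which are their own dual basis. *)
exists (fun e k => (fsum e k)%:Z) => _ _ /mapP[k _ ->] /mapP[l _ ->].
rewrite (inj_eq Uinj) /ev /fsum /= (bigD1 k) //= big1 => [|i ik].
  by rewrite !mnm1E eqxx mul1r addr0 eq_sym; case: (k == l).
by rewrite mnm1E eq_sym (negPf ik) mul0r.
Qed.

Lemma size_root (G : m.-tuple ('I_n * 'I_n)) : size (root_graph G) = m.
Proof. by rewrite size_map size_enum_ord. Qed.

End OrderO.
End ReductionTrees.

Theorem theorem10 (n m : nat) (G : m.-tuple ('I_n * 'I_n))
  (hG : forall k : 'I_m, ((tnth G k).1 < (tnth G k).2)%N)
  (tI tO : rel 'X_{1..m}) (htI : total_order tI) (htO : total_order tO)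
  (T : rtree n m) (hT : reduction_tree (order_O tI tO) (root_graph G) T) :
  shifted_reduced_form T = h_poly T
  /\ (forall u : 'X_{1..n}, 0 <= (shifted_reduced_form T)@_u).
Proof.
have gG := good_root hG.
rewrite shifted_reduced_formE (leaves_shell_sum htI htO gG hT).
rewrite (h_poly_shell htI htO gG (size_root G) hT).
by split=> // u; exact: shell_sum_ge0.
Qed.
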